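(* Let $d\geq 2$ be an integer, let $e_1,\dots,e_d$ be the standard basis of $\mathbb{Z}^d$, let $U=\{\pm e_i : i=1,\dots,d\}\cup\{\pm 2e_1\}$, and let $\mathbb{Z}^d_U$ be the undirected Cayley graph on $\mathbb{Z}^d$ with generating set $U$. Then the edge isoperimetric problem for $\mathbb{Z}^d_U$ does not have nested solutions starting at any size. In other words: for every $n\in\mathbb{N}$ and every $n$-element subset $S_n$ of $\mathbb{Z}^d$ for which $\partial(S_n)$ is the minimum of $\partial$ among all $n$-element subsets of $\mathbb{Z}^d$, there does not exist an infinite sequence $S_n\subset S_{n+1}\subset S_{n+2}\subset\cdots$ of subsets of $\mathbb{Z}^d$ with $|S_i|=i$ for all $i\geq n$ such that, for each $i\geq n$, $\partial(S_i)$ is the minimum of $\partial$ among all $i$-element subsets of $\mathbb{Z}^d$.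
   Context: For a finite symmetric set $U\subset\mathbb{Z}^d\setminus\{0\}$ that generates $\mathbb{Z}^d$ as a group, $\mathbb{Z}^d_U$ denotes the undirected graph with vertex set $\mathbb{Z}^d$ in which $x$ and $y$ are joined by an edge if and only if $y-x\in U$. For a graph $G$ and $S\subseteq V(G)$, the edge boundary is the number $\partial(S)=|\{uv\in E(G): u\in S,\ v\notin S\}|$; here it is taken with respect to $G=\mathbb{Z}^d_U$. *)

(* Defs.v *)
From mathcomp Require Import all_boot all_order all_algebra finmap.

Set Implicit Arguments.
Unset Strict Implicit.
Unset Printing Implicit Defensive.

Import GRing.Theory.

Local Open Scope fset_scope.
Local Open Scope ring_scope.

Definition cayley_adj d (U : {fset 'rV[int]_d}) : rel 'rV[int]_d :=
  fun x y => y - x \in U.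

(* Edges are unordered pairs [fset x; y]. The boundary edges of S are listed as
   the pairs {x, x + u} with x in S, u in U and x + u outside S, which makes
   their set finite by construction. *)
Definition boundary_edges d (U : {fset 'rV[int]_d}) (S : {fset 'rV[int]_d}) :
    {fset {fset 'rV[int]_d}} :=
  [fset [fset x; (x + u)%R] | x in S, u in U & (x + u)%R \notin S].

Definition edge_boundary d (U S : {fset 'rV[int]_d}) : nat :=
  #|` boundary_edges U S|.

Lemma boundary_edgesP d (U S : {fset 'rV[int]_d}) (e : {fset 'rV[int]_d}) :
  reflect (exists x y, [/\ e = [fset x; y], cayley_adj U x y,
                           x \in S & y \notin S])
          (e \in boundary_edges U S).
Proof.
apply: (iffP (imfset2P _ _ _ _ _)) => /= [[x xS [u]]|[x [y [-> xy xS yS]]]].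
  rewrite inE /= => /andP[uU xuS] ->; exists x, (x + u); split=> //.
  by rewrite /cayley_adj addrAC subrr add0r.
have xE : x + (y - x) = y by rewrite addrC subrK.
by exists x => //; exists (y - x); rewrite ?inE /= xE ?yS ?andbT.
Qed.

Definition edge_optimal d (U : {fset 'rV[int]_d}) (n : nat)
    (S : {fset 'rV[int]_d}) : Prop :=
  #|` S| = n /\
  forall T : {fset 'rV[int]_d}, #|` T| = n ->
    (edge_boundary U S <= edge_boundary U T)%N.

(* {+- e_i} together with {+- 2 e_1}. Coordinates are numbered from 0, so e_1 is
   the basis vector whose index is 0, and it exists as soon as d > 0. *)
Definition genU d : {fset 'rV[int]_d} :=
  [fset delta_mx 0 i | i in 'I_d] `|`
  [fset - delta_mx 0 i | i in 'I_d] `|`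
  [fset delta_mx 0 i *+ 2 | i in 'I_d & i == 0%N :> nat] `|`
  [fset - (delta_mx 0 i *+ 2) | i in 'I_d & i == 0%N :> nat].

Lemma genUP d (u : 'rV[int]_d) :
  reflect (exists i : 'I_d,
            [\/ u = delta_mx 0 i, u = - delta_mx 0 i |
             i = 0%N :> nat /\ (u = delta_mx 0 i *+ 2 \/ u = - (delta_mx 0 i *+ 2))])
          (u \in genU d).
Proof.
rewrite !in_fsetU -!orbA; apply: (iffP or4P) => [[]|[i []]].
- by case/imfsetP => i /= _ ->; exists i; constructor 1.
- by case/imfsetP => i /= _ ->; exists i; constructor 2.
- by case/imfsetP => i /=; rewrite inE => /eqP i0 ->; exists i; constructor 3; split=> //; left.
- by case/imfsetP => i /=; rewrite inE => /eqP i0 ->; exists i; constructor 3; split=> //; right.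
- by move=> ->; constructor 1; apply/imfsetP; exists i.
- by move=> ->; constructor 2; apply/imfsetP; exists i.
case=> i0 [] ->; [constructor 3 | constructor 4]; apply/imfsetP; exists i => //=;
  by rewrite inE i0.
Qed.

Lemma genU_sym d (u : 'rV[int]_d) : (- u \in genU d) = (u \in genU d).
Proof.
suff sub v : v \in genU d -> - v \in genU d.
  by apply/idP/idP => [/sub|/sub //]; rewrite opprK.
case/genUP => i h; apply/genUP; exists i.
case: h => [->|->|[i0 [] ->]]; rewrite ?opprK.
- by constructor 2.
- by constructor 1.
- by constructor 3; split=> //; right.
by constructor 3; split=> //; left.
Qed.

Lemma genU_neq0 d : 0 \notin genU d.
Proof.
apply/genUP => -[i] [|| [_ []]] /matrixP/(_ 0 i) /eqP;
  by rewrite !mxE ?mulmxnE !eqxx.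
Qed.

(* Main.v *)
Require Import Defs.
From mathcomp Require Import all_boot all_order all_algebra finmap.
From mathcomp Require Import perm zify ring.

(** For a box with sides 3k, k, ..., k every axis-parallel line meeting a set S
    costs at least 2 boundary edges, and at least 6 in direction 0 unless it
    meets S in a single point.  A discrete Knothe map and the AM-GM inequality
    then show that, for large k, the unique optimal sets of size 3k^d are the
    products A_0 x ... x A_(d-1) with #A_0 = 3k and #A_i = k otherwise.

    In a nested sequence the sets of sizes between 3k^d and 3(k+1)^d are thus
    squeezed between two such products, and up to O(k^(d-2)) points they
    consist of the smaller one and parts of the 3 + (d-1) slabs separating it
    from the larger one.  A partially filled slab is expensive: joining a point
    inside to a point outside by changing one coordinate at a time shows that a
    part of density t exceeds the linear cost by order t(1-t)k^(d-2).  So at the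
    sizes of the boxes (3k+2) x k^(d-1) and (3k+1) x (k+1) x k^(d-2) every slab
    is nearly empty or nearly full.  Slabs of direction 0 have volume k^(d-1),
    the others 3k^(d-1); hence two slabs of direction 0 are full at the first
    size, but at the second size, being full slabs of total volume 4k^(d-1) with
    at most three of direction 0, exactly one is: a contradiction. *)

Set Implicit Arguments.
Unset Strict Implicit.
Unset Printing Implicit Defensive.

Import Order.TTheory GRing.Theory Num.Theory.

Local Open Scope fset_scope.
Local Open Scope nat_scope.

(** * Counting in finite sets *)

Lemma card_fset_sum_cond (T : choiceType) (A : {fset T}) (P : pred T) :
  #|` [fset x in A | P x]| = \sum_(x <- A) P x.
Proof.
rewrite card_fset_sum1 -big_fset_condE big_mkcond /=.
by apply: eq_bigr => x _; case: (P x).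
Qed.

Lemma leq_card_in_fset (T T' : choiceType) (f : T -> T') (A : {fset T}) (B : {fset T'}) :
  {in A &, injective f} -> {in A, forall x, f x \in B} -> #|` A| <= #|` B|.
Proof.
move=> injf fB; rewrite -(card_in_imfset imfset_key injf).
by apply: fsubset_leq_card; apply/fsubsetP => _ /imfsetP[x /= xA ->]; apply: fB.
Qed.

Lemma sum_disjoint_le (I : eqType) (T : choiceType) (r : seq I) (P : pred I)
    (B : I -> {fset T}) (L : {fset T}) (g : T -> nat) :
  uniq r -> (forall t, t \in r -> P t -> B t `<=` L) ->
  (forall t t' y, t \in r -> t' \in r -> P t -> P t' ->
     y \in B t -> y \in B t' -> t = t') ->
  \sum_(t <- r | P t) \sum_(y <- B t) g y <= \sum_(y <- L) g y.
Proof.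
elim: r L => [|t r IH] L; first by rewrite big_nil.
move=> /= /andP[tr ur] subL inj; rewrite big_cons; case: ifP => Pt; last first.
  apply: IH => // [t' t'r|t' t'' y t'r t''r]; first by apply: subL; rewrite inE t'r orbT.
  by apply: inj; rewrite inE ?t'r ?t''r orbT.
have tL : B t `<=` L by apply: subL => //; rewrite inE eqxx.
rewrite [leqRHS](big_fsetID _ (mem (B t))) /=.
have -> : [fset x in L | x \in B t] = B t.
  by apply/fsetP => x; rewrite !inE andbC; case: (boolP (x \in B t)) => //= /(fsubsetP tL) ->.
rewrite leq_add2l; apply: IH => // [t' t'r Pt'|t' t'' y t'r t''r]; last first.
  by apply: inj; rewrite inE ?t'r ?t''r orbT.
apply/fsubsetP => y yt'; rewrite !inE /=.
have -> : y \in L by apply: (fsubsetP (subL t' _ Pt')) => //; rewrite inE t'r orbT.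
apply/negP => yt; have tt' : t = t' by apply: (inj t t' y) => //; rewrite inE ?eqxx ?t'r ?orbT.
by rewrite tt' t'r in tr.
Qed.

Lemma cardfsM (K K' : choiceType) (A : {fset K}) (B : {fset K'}) :
  #|` A `*` B| = #|` A| * #|` B|.
Proof.
rewrite card_fset_sum1 big_imfset2 /=; last by move=> [x y] [x' y'] _ _ /= [-> ->].
rewrite [in RHS]card_fset_sum1 big_distrl /=.
by apply: eq_bigr => x _; rewrite card_fset_sum1 mul1n.
Qed.

(** * Lines and boxes *)

Section Points.
Variable d : nat.
Implicit Types (x y u v w : 'rV[int]_d) (S X : {fset 'rV[int]_d}) (A : 'I_d -> {fset int}).

(** A line of direction [i] is named by its point with [i]-th coordinate 0, so [lines i S] is the
    projection of [S] along [i]. *)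
Definition flat (i : 'I_d) x : 'rV[int]_d := (\row_j (if j == i then 0 else x ord0 j))%R.

Definition lines (i : 'I_d) S : {fset 'rV[int]_d} := [fset flat i x | x in S].

Definition len (i : 'I_d) S y : nat := #|` [fset x in S | flat i x == y]|.

Lemma flatP (i : 'I_d) x y :
  reflect (forall j, j != i -> x ord0 j = y ord0 j) (flat i x == flat i y).
Proof.
apply: (iffP eqP) => [/matrixP h j ji|h].
  by have := h ord0 j; rewrite !mxE (negPf ji).
by apply/rowP => j; rewrite !mxE; case: ifPn => // /h.
Qed.

Lemma flat_inj (i : 'I_d) x y : flat i x = flat i y -> x ord0 i = y ord0 i -> x = y.
Proof.
move/eqP/flatP => h hi; apply/rowP => j.
by case: (eqVneq j i) => [->//|/h].
Qed.

Lemma mem_lines (i : 'I_d) S x : x \in S -> flat i x \in lines i S.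
Proof. by move=> xS; apply/imfsetP; exists x. Qed.

Lemma linesS (i : 'I_d) S S' : S `<=` S' -> lines i S `<=` lines i S'.
Proof.
move=> /fsubsetP h; apply/fsubsetP => _ /imfsetP[x /= xS ->].
by apply: mem_lines; apply: h.
Qed.

Lemma card_lines (i : 'I_d) S : #|` lines i S| <= #|` S|.
Proof. exact: leq_imfset_card. Qed.

Lemma sum_len (i : 'I_d) S : \sum_(y <- lines i S) len i S y = #|` S|.
Proof.
rewrite [RHS]card_fset_sum1 [RHS](partition_big_imfset _ (flat i)) /=.
by apply: eq_bigr => y _; rewrite /len card_fset_sum1 -big_fset_condE.
Qed.

Lemma len_gt0 (i : 'I_d) S y : y \in lines i S -> 0 < len i S y.
Proof.
case/imfsetP => x /= xS ->; rewrite cardfs_gt0; apply/fset0Pn; exists x.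
by rewrite !inE xS eqxx.
Qed.

Lemma lenS (i : 'I_d) S S' y : S `<=` S' -> len i S y <= len i S' y.
Proof.
move=> /fsubsetP h; apply: fsubset_leq_card; apply/fsubsetP => x; rewrite !inE.
by move=> /andP[/h -> ->].
Qed.

(** Realised through functions into the union [U] of all sides, a single finite type. *)
Definition box A : {fset 'rV[int]_d} :=
  let U := \big[fsetU/fset0]_(i < d) A i in
  [fset (\row_i val (f i))%R
    | f : {ffun 'I_d -> U} in family (fun i => [pred t : U | val t \in A i])].

Lemma boxP A x : reflect (forall i, x ord0 i \in A i) (x \in box A).
Proof.
rewrite /box; set U := \big[fsetU/fset0]_(i < d) A i.
apply: (iffP (imfsetP _ _ _ _)) => [[f /= /familyP h ->] i|h].
  by rewrite mxE; have := h i; rewrite inE.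
have hU i : x ord0 i \in U.
  by apply/bigfcupP; exists i; rewrite ?mem_index_enum.
exists [ffun i => FSetSub (hU i)] => /=.
  by apply/familyP => i; rewrite ffunE inE /=.
by apply/rowP => i; rewrite mxE ffunE.
Qed.

Lemma card_box A : #|` box A| = \prod_i #|` A i|.
Proof.
rewrite /box; set U := \big[fsetU/fset0]_(i < d) A i.
rewrite card_imfset /=; last first.
  move=> f g /rowP h; apply/ffunP => i; apply: val_inj.
  by have := h i; rewrite !mxE.
rewrite -cardE card_family foldrE big_map big_enum /=; apply: eq_bigr => i _.
have AU : A i `<=` U by apply: bigfcup_sup; rewrite ?mem_index_enum.
rewrite -(card_fsub AU) cardsE; apply: eq_card => t.
by [].
Qed.

Lemma len_box A i X y : X `<=` box A -> len i X y <= #|` A i|.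
Proof.
move=> /fsubsetP XA; apply: (leq_card_in_fset (f := fun x => x ord0 i)) => [x z|x]; rewrite !inE /=.
  by move=> /andP[_ /eqP <-] /andP[_ /eqP /esym]; apply: flat_inj.
by move=> /andP[/XA /boxP].
Qed.

Definition upd A (j : 'I_d) (B : {fset int}) := fun i => if i == j then B else A i.

End Points.

(** * Sets inside a box *)

Section Paths.
Variable d : nat.
Implicit Types (x y u v w : 'rV[int]_d) (S X : {fset 'rV[int]_d}) (A : 'I_d -> {fset int}).

Definition hyb (m : nat) u v : 'rV[int]_d :=
  (\row_j if (j < m)%N then v ord0 j else u ord0 j)%R.

Lemma hyb_crossing X u v : u \in X -> v \notin X ->
  exists i : 'I_d, (hyb i u v \in X) && (hyb i.+1 u v \notin X).
Proof.
move=> uX vX.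
have h0 : hyb 0 u v \in X.
  by suff -> : hyb 0 u v = u by []; apply/rowP => j; rewrite mxE.
have hd : hyb d u v \notin X.
  by suff -> : hyb d u v = v by []; apply/rowP => j; rewrite mxE ltn_ord.
have exm : exists m, hyb m u v \notin X by exists d.
case: (ex_minnP exm) => -[|m] hm minm; first by rewrite h0 in hm.
have md : m < d by apply: minm.
exists (Ordinal md) => /=; rewrite hm andbT.
by apply/negPn/negP => /minm; rewrite ltnn.
Qed.

Lemma hyb_box A m u v : u \in box A -> v \in box A -> hyb m u v \in box A.
Proof.
by move=> /boxP uA /boxP vA; apply/boxP => j; rewrite mxE; case: ifP.
Qed.

Lemma flat_hyb (i : 'I_d) u v : flat i (hyb i.+1 u v) = flat i (hyb i u v).
Proof.
apply/eqP/flatP => j ji; rewrite !mxE ltnS leq_eqVlt.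
by rewrite (negPf ji : (j == i :> nat) = false).
Qed.

Lemma hyb_inj m u v u' v' :
  (hyb m u v, hyb m v u) = (hyb m u' v', hyb m v' u') -> (u, v) = (u', v').
Proof.
case=> /rowP h1 /rowP h2; congr pair; apply/rowP => j.
  by move: (h1 j) (h2 j); rewrite !mxE; case: ifP.
by move: (h1 j) (h2 j); rewrite !mxE; case: ifP.
Qed.

Definition sibs A (i : 'I_d) X : {fset 'rV[int]_d} :=
  [fset w in box A | (w \notin X) && (flat i w \in lines i X)].

Lemma card_sibs A i X : X `<=` box A ->
  #|` sibs A i X| + #|` X| <= #|` A i| * #|` lines i X|.
Proof.
move=> XA; pose W := [fset w in box A | flat i w \in lines i X].
have XW : X `<=` W.
  by apply/fsubsetP => x xX; rewrite !inE (fsubsetP XA) // mem_lines.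
have <- : W `\` X = sibs A i X.
  by apply/fsetP => w; rewrite !inE andbCA.
rewrite cardfsDS // subnK ?fsubset_leq_card // -(sum_len i W).
have lW : lines i W = lines i X.
  apply/eqP; rewrite eqEfsubset; apply/andP; split; last exact: linesS.
  by apply/fsubsetP => _ /imfsetP[w /= wW ->]; move: wW; rewrite !inE => /andP[].
rewrite lW mulnC card_fset_sum1 big_distrl /=; apply: leq_sum => y _; rewrite mul1n.
by apply: (len_box (A := A)); apply/fsubsetP => w; rewrite !inE => /andP[].
Qed.

(* Send a pair (u, v) with u in X and v outside to the first step of the path
   u = hyb 0, ..., hyb d = v that leaves X, together with the complementary
   hybrid, from which (u, v) can be recovered. *)
Lemma path_ineq A X : X `<=` box A ->
  #|` X| * (#|` box A| - #|` X|) <= #|` box A| * \sum_i #|` sibs A i X|.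
Proof.
move=> XA; rewrite -cardfsDS //.
set V := box A `\` X.
have step u v : u \in X -> v \in V ->
    (1 <= \sum_(i < d) ((hyb i u v \in X) && (hyb i.+1 u v \notin X)))%N.
  move=> uX; rewrite inE => /andP[vX _].
  by have [i hi] := hyb_crossing uX vX; rewrite (bigD1 i) //= hi.
pose P i := [fset p in X `*` V | (hyb (i : 'I_d) p.1 p.2 \in X) && (hyb i.+1 p.1 p.2 \notin X)].
have -> : #|` X| * #|` V| = #|` X `*` V|.
  by rewrite cardfsM.
apply: (@leq_trans (\sum_i #|` P i|)).
  under eq_bigr do rewrite card_fset_sum_cond.
  rewrite exchange_big /= card_fset_sum1 big_seq [leqRHS]big_seq.
  apply: leq_sum => -[u v]; rewrite inE => /andP[uX vV]; exact: step.
rewrite big_distrr /=; apply: leq_sum => i _.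
rewrite mulnC -cardfsM.
apply: (leq_card_in_fset (f := fun p => (hyb i.+1 p.1 p.2, hyb i.+1 p.2 p.1))).
  by move=> [u v] [u' v'] _ _; apply: hyb_inj.
move=> [u v]; rewrite !inE /= => /andP[/andP[uX /andP[vX vA]] /andP[h1 h2]].
have uA : u \in box A by apply: (fsubsetP XA).
apply/andP; split; last exact: hyb_box.
apply/and3P; split; [exact: hyb_box | exact: h2 | by rewrite flat_hyb mem_lines].
Qed.

(** Path counting forces many missing points on the lines of [X], and [card_sibs] turns these into a
    surplus of lines. The surplus term is quadratic and vanishes only for empty or full [X]. *)
Lemma sum_lines_ge A X : X `<=` box A ->
  #|` X| * (#|` box A| - #|` X|) + d * #|` box A| * #|` X| <=
  #|` box A| * \sum_i #|` A i| * #|` lines i X|.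
Proof.
move=> XA; apply: (@leq_trans (#|` box A| * \sum_i (#|` sibs A i X| + #|` X|))).
  rewrite big_split /= mulnDr sum_nat_const card_ord leq_add ?path_ineq //.
  by rewrite mulnA (mulnC d).
by rewrite leq_mul2l leq_sum ?orbT // => i _; apply: card_sibs.
Qed.

End Paths.

(** * The Knothe map and the isoperimetric inequality *)

(** The second half is the equality case of AM-GM: with mean 1 and product at least 1, all entries
    coincide with their mean. *)
Lemma AGM_ge1 (d : nat) (E : 'I_d -> rat) :
  (forall i, 0 <= E i)%R -> (1 <= \prod_i E i)%R ->
  (d%:R <= \sum_i E i)%R /\ ((\sum_i E i <= d%:R)%R -> forall i, E i = 1%R).
Proof.
case: d E => [|d] E E0 E1.
  by split=> [|_ []//]; rewrite big_ord0.
have /= := @leif_AGM _ _ predT E (fun i _ => E0 i).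
rewrite card_ord; set mu := (_ / _)%R => AGM.
have d0 : (0 < d.+1%:R :> rat)%R by rewrite ltr0n.
have mu1 : (1 <= mu)%R.
  rewrite leNgt; apply/negP => mu1.
  have mu0 : (0 <= mu)%R by rewrite divr_ge0 ?sumr_ge0 // ltW.
  have := le_trans E1 AGM; rewrite leNgt => /negP; apply.
  by rewrite exprn_ilt1.
split=> [|sumE i]; first by move: mu1; rewrite ler_pdivlMr // mul1r.
have muE : mu = 1%R.
  by apply/eqP; rewrite eq_le mu1 andbT ler_pdivrMr // mul1r.
move: AGM => /leifP; rewrite muE expr1n.
case: ifPn => [/forall_inP eqE _|_ ]; last by rewrite ltNge E1.
have eqEi j : E j = E i by apply/eqP; apply: (forall_inP (eqE j isT)).
move: muE; rewrite /mu (eq_bigr (fun=> E i)) // sumr_const card_ord.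
by rewrite -[(E i *+ _)%R]mulr_natr mulfK ?gt_eqF.
Qed.

Section Knothe.
Variables (d : nat) (sigma : {perm 'I_d}) (a : 'I_d -> nat).
Variable S : {fset 'rV[int]_d}.
Implicit Types (s t : 'rV[int]_d).

(** [sigma j] is the rank of coordinate [j] in the order in which coordinates are fixed. Leaving the
    order free lets any coordinate come first in [sum_lines_eq_box]. *)
Definition agree (m : nat) s t := [forall j : 'I_d, (sigma j < m) ==> (t ord0 j == s ord0 j)].

Definition pre m s := #|` [fset t in S | agree m s t]|.

Lemma agreeP m s t :
  reflect (forall j : 'I_d, sigma j < m -> t ord0 j = s ord0 j) (agree m s t).
Proof.
apply: (iffP forallP) => h j; first by move=> hj; have := h j; rewrite hj => /eqP.
by apply/implyP => /h ->.
Qed.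

Lemma pre_gt0 m s : s \in S -> 0 < pre m s.
Proof.
move=> sS; rewrite cardfs_gt0; apply/fset0Pn; exists s; rewrite !inE sS /=.
by apply/agreeP.
Qed.

Lemma pre0 s : pre 0 s = #|` S|.
Proof.
congr #|` _|; apply/fsetP => t; rewrite !inE.
by case: (t \in S) => //=; apply/agreeP.
Qed.

Lemma pre_max s : s \in S -> pre d s = 1.
Proof.
move=> sS; apply/eqP/cardfs1P; exists s; apply/fsetP => t; rewrite !inE.
apply/idP/eqP => [/andP[_ /agreeP h]|->]; last by rewrite sS; apply/agreeP.
by apply/rowP => j; apply: h; apply: ltn_ord.
Qed.

(** Points on one line of direction [i] agree in all coordinates of rank below [sigma i] and differ
    in coordinate [i], so they define disjoint classes inside the set counted by
    [pre (sigma i) s0]. *)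
Lemma sum_pre_line (i : 'I_d) s0 : s0 \in S ->
  \sum_(s <- S | flat i s == flat i s0) pre (sigma i).+1 s <= pre (sigma i) s0.
Proof.
move=> s0S; rewrite /pre [leqRHS]card_fset_sum1.
under eq_bigr do rewrite card_fset_sum1.
apply: sum_disjoint_le => [|s sS /flatP ss0|s s' t sS s'S /eqP es /eqP es'].
- exact: fset_uniq.
- apply/fsubsetP => t; rewrite !inE => /andP[-> /agreeP h] /=.
  apply/agreeP => j ji; rewrite (h _ (ltnW ji)); apply: ss0.
  by apply: contraTneq ji => ->; rewrite ltnn.
- rewrite !inE => /andP[_ /agreeP h] /andP[_ /agreeP h'].
  apply: (@flat_inj _ i); first by rewrite es es'.
  by rewrite -h ?h' ?leqnn.
Qed.

Local Open Scope ring_scope.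

(* The i-th diagonal entry of the derivative of the triangular (Knothe) map
   from S onto the box with sides a: the product of the entries is the volume
   ratio, and along a line of direction i they sum to at most a i. *)
Definition ratio (i : 'I_d) s : rat :=
  (a i)%:R * ((pre (sigma i).+1 s)%:R / (pre (sigma i) s)%:R).

Lemma ratio_ge0 i s : 0 <= ratio i s.
Proof. by rewrite mulr_ge0 ?divr_ge0 ?ler0n. Qed.

(** Ordered by rank, the product telescopes from [pre 0 s], the size of [S], to [pre d s = 1]. *)
Lemma prod_ratio s : s \in S -> \prod_i ratio i s = (\prod_i a i)%:R / #|` S|%:R.
Proof.
move=> sS; rewrite big_split /= natr_prod; congr (_ * _).
pose f m : rat := (pre m s)%:R.
have fU m : f m != 0 by rewrite pnatr_eq0 -lt0n pre_gt0.
rewrite -(reindex_inj (@perm_inj _ sigma) (P := predT) (F := fun j : 'I_d => f j.+1 / f j)).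
rewrite -(big_mkord predT (fun m => f m.+1 / f m)) /=.
have -> m : \prod_(0 <= i < m) (f i.+1 / f i) = f m / f 0%N.
  elim: m => [|m IH]; first by rewrite big_geq // divff.
  by rewrite big_nat_recr //= IH mulrC mulrA mulrVK ?unitfE.
by rewrite /f pre_max // pre0 mul1r.
Qed.

Lemma sum_ratio_line i : \sum_(s <- S) ratio i s <= (a i * #|` lines i S|)%:R.
Proof.
rewrite natrM -mulr_sumr ler_wpM2l ?ler0n //.
rewrite (partition_big_imfset _ (flat i)) /= -[[fset _ | _ in S]]/(lines i S).
rewrite card_fset_sum1 natr_sum big_seq [leRHS]big_seq.
apply: ler_sum => _ /imfsetP[s0 /= s0S ->].
have p0 : 0 < (pre (sigma i) s0)%:R :> rat by rewrite ltr0n pre_gt0.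
rewrite (eq_bigr (fun s => (pre (sigma i).+1 s)%:R / (pre (sigma i) s0)%:R)); last first.
  move=> s /flatP ss0; congr (_ / _%:R); congr #|` _|.
  apply/fsetP => t; rewrite !inE; case: (t \in S) => //=.
  have eqs (j : 'I_d) : (sigma j < sigma i)%N -> s ord0 j = s0 ord0 j.
    by move=> ji; apply: ss0; apply: contraTneq ji => ->; rewrite ltnn.
  by apply/agreeP/agreeP => h j ji; rewrite h ?eqs.
by rewrite -mulr_suml ler_pdivrMr // mul1r -natr_sum ler_nat sum_pre_line.
Qed.

Hypothesis card_le : (#|` S| <= \prod_i a i)%N.

Lemma prod_ratio_ge1 s : s \in S -> 1 <= \prod_i ratio i s.
Proof.
move=> sS; rewrite prod_ratio //.
have S0 : 0 < (#|` S|%:R : rat) by rewrite ltr0n cardfs_gt0; apply/fset0Pn; exists s.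
by rewrite ler_pdivlMr // mul1r ler_nat.
Qed.

Lemma sum_ratio_ge : \sum_(s <- S) \sum_i ratio i s <= (\sum_i a i * #|` lines i S|)%:R.
Proof.
by rewrite exchange_big natr_sum; apply: ler_sum => i _; apply: sum_ratio_line.
Qed.

(** AM-GM at each point of [S], summed over [S] and regrouped along lines: a weighted inequality of
    Loomis-Whitney type. *)
Lemma sum_lines_ge_card : (d * #|` S| <= \sum_i a i * #|` lines i S|)%N.
Proof.
rewrite -(ler_nat rat); apply: le_trans sum_ratio_ge.
rewrite natrM card_fset_sum1 natr_sum mulr_sumr big_seq [leRHS]big_seq.
apply: ler_sum => s sS; rewrite mulr1.
by have [] := AGM_ge1 (ratio_ge0^~ s) (prod_ratio_ge1 sS).
Qed.

Lemma sum_lines_eq_ratio : (\sum_i a i * #|` lines i S| <= d * #|` S|)%N ->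
  forall s i, s \in S -> ratio i s = 1.
Proof.
move=> le s i sS; have [_ ] := AGM_ge1 (ratio_ge0^~ s) (prod_ratio_ge1 sS); apply.
have sum_le : \sum_(s <- S) \sum_i ratio i s <= \sum_(s <- S) d%:R.
  apply: (le_trans sum_ratio_ge); rewrite -natr_sum ler_nat; apply: (leq_trans le).
  by rewrite card_fset_sum1 big_distrr /=; under eq_bigr do rewrite muln1.
(* Every point contributes at least [d], so an excess at [s] alone would make the total too
   large. *)
move: sum_le; rewrite (big_fsetD1 s) //= [leRHS](big_fsetD1 s) //=.
apply: contraTT; rewrite -!ltNge => lt; apply: ltr_leD => //.
rewrite big_seq [leRHS]big_seq; apply: ler_sum => t; rewrite !inE => /andP[_ tS].
by have [] := AGM_ge1 (ratio_ge0^~ t) (prod_ratio_ge1 tS).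
Qed.

End Knothe.

(** With coordinate [i] fixed first, equality says that all nonempty sections of [S] at a value of
    coordinate [i] have the same size, that of [S] divided by [a i]. Hence coordinate [i] takes
    exactly [a i] values, and [S] has as many points as the box of its projections. *)
Lemma sum_lines_eq_box (d : nat) (a : 'I_d.+1 -> nat) (S : {fset 'rV[int]_d.+1}) :
  0 < #|` S| -> #|` S| = \prod_i a i ->
  \sum_i a i * #|` lines i S| <= d.+1 * #|` S| ->
  exists2 A : 'I_d.+1 -> {fset int}, S = box A & forall i, #|` A i| = a i.
Proof.
move=> S0 cardS le.
pose A (i : 'I_d.+1) : {fset int} := [fset (x : 'rV[int]_d.+1) ord0 i | x in S].
have cA i : #|` A i| = a i.
  pose sg := tperm i ord0.
  have fib s : s \in S -> a i * #|` [fset t in S | t ord0 i == s ord0 i]| = #|` S|.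
    move=> sS; have := sum_lines_eq_ratio sg (eq_leq cardS) le i sS.
    rewrite /ratio tpermL pre0.
    rewrite mulrA => /divr1_eq /eqP.
    rewrite -natrM eqr_nat => /eqP <-; congr (_ * #|` _|).
    apply/fsetP => t; rewrite !inE; case: (t \in S) => //=.
    apply/eqP/agreeP => [h j|->//]; last by rewrite tpermL.
    rewrite ltnS leqn0 => /eqP j0; suff -> : j = i by [].
    by apply: (@perm_inj _ sg); apply: val_inj; rewrite tpermL.
  apply/eqP; rewrite -(eqn_pmul2r S0).
  suff : \sum_(c <- A i) (a i * #|` [fset t in S | t ord0 i == c]|) = a i * #|` S|.
    rewrite big_seq (eq_bigr (fun=> #|` S|)); last first.
      by move=> c cA; have [s /= sS ->] := imfsetP _ _ _ _ cA; apply: fib.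
    rewrite -big_seq => <-; rewrite [#|` A i|]card_fset_sum1 big_distrl /=.
    by under [X in X == _]eq_bigr do rewrite mul1n.
  rewrite -big_distrr /=; congr (_ * _).
  rewrite [RHS]card_fset_sum1 [RHS](partition_big_imfset _ (fun x : 'rV[int]_d.+1 => x ord0 i)) /=.
  by apply: eq_bigr => c _; rewrite card_fset_sum1 -big_fset_condE.
exists A => //; apply/eqP; rewrite eqEfcard; apply/andP; split.
  by apply/fsubsetP => x xS; apply/boxP => i; apply/imfsetP; exists x.
by rewrite card_box cardS; under eq_bigr do rewrite cA.
Qed.

(** * Boundary edges along a line *)

Section Boundary.
Variable d : nat.
Implicit Types (x y u v w : 'rV[int]_d) (S X : {fset 'rV[int]_d}) (A : 'I_d -> {fset int}).

Definition shift (i : 'I_d) (m : int) x : 'rV[int]_d := (x + delta_mx ord0 i *~ m)%R.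

Definition jumps (i : 'I_d) : seq int :=
  (if i == 0%N :> nat then [:: 1; -1; 2; -2] else [:: 1; -1])%R.

Definition line_cost (i : 'I_d) S y : nat :=
  \sum_(x <- S | flat i x == y) \sum_(m <- jumps i) (shift i m x \notin S).

Lemma shiftE i m x j : (shift i m x ord0 j = x ord0 j + (if j == i then m else 0))%R.
Proof.
rewrite /shift !mxE -scaler_int !mxE eqxx /=; congr (_ + _)%R.
by case: eqP => _; rewrite ?mulr1 ?mulr0 ?intz.
Qed.

Lemma flat_shift i m x : flat i (shift i m x) = flat i x.
Proof. by apply/eqP/flatP => j ji; rewrite shiftE (negPf ji) addr0. Qed.

Lemma jumps_neq0 i m : m \in jumps i -> m != 0%R.
Proof. by rewrite /jumps; case: ifP => _; rewrite !inE; case/or4P || case/orP; move/eqP ->. Qed.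

Lemma big_genU (f : 'rV[int]_d -> nat) :
  \sum_(u <- genU d) f u = \sum_i \sum_(m <- jumps i) f (delta_mx ord0 i *~ m)%R.
Proof.
have dE (i j : 'I_d) (m : int) :
    (delta_mx (ord0 : 'I_1) i *~ m)%R ord0 j = (if j == i then m else 0%R).
  by rewrite -scaler_int !mxE eqxx /=; case: eqP => _; rewrite ?mulr1 ?mulr0 ?intz.
transitivity (\sum_(u <- [seq (delta_mx (ord0 : 'I_1) i *~ m)%R
    | i <- index_enum ('I_d : finType), m <- jumps i]) f u); last by rewrite big_allpairs_dep.
apply: perm_big; apply: uniq_perm.
- exact: fset_uniq.
- apply: allpairs_uniq_dep.
  + exact: index_enum_uniq.
  + by move=> i _; rewrite /jumps; case: ifP.
  + move=> [i m] [j n] /allpairsPdep[i' [m' [_ m'i e0]]] _ /= /rowP e.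
    have m0 : m != 0%R.
      apply: (@jumps_neq0 i).
      by have /= -> := congr1 (fun p => tagged p \in jumps (tag p)) e0.
    have := e i; rewrite !dE eqxx.
    case: eqP => [ij mn|_ m00]; last by rewrite m00 eqxx in m0.
    by rewrite ij mn.
- move=> u; apply/genUP/allpairsPdep => [[i h]|[i [m [_ mi ->]]]].
    case: h => [->|->|[i0 [] ->]]; [exists i, 1%R|exists i, (-1)%R|exists i, 2%R|exists i, (-2)%R];
      rewrite mem_index_enum /jumps ?i0 /= ?inE; split=> //; by case: ifP.
  exists i; move: mi; rewrite /jumps; case: ifP => i0; rewrite !inE.
    case/or4P => /eqP ->.
    - by constructor 1.
    - by constructor 2.
    - by constructor 3; split; [apply/eqP|left].
    - by constructor 3; split; [apply/eqP|right].
  case/orP => /eqP ->.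
  - by constructor 1.
  - by constructor 2.
Qed.

(** A boundary edge has exactly one endpoint in [S], so edges correspond to pairs of a point of [S]
    and a generator leading out of [S]. *)
Lemma edge_boundaryE S :
  edge_boundary (genU d) S = \sum_i \sum_(y <- lines i S) line_cost i S y.
Proof.
move: (genU d) big_genU => U big_U.
pose P := [fset p in S `*` U | (p.1 + p.2)%R \notin S].
have -> : edge_boundary U S = #|` [fset [fset p.1; (p.1 + p.2)%R] | p in P]|.
  congr #|` _|; apply/fsetP => e; apply/imfset2P/imfsetP => /=.
    move=> [x xS [u]]; rewrite inE /= => /andP[uU xu] ->; exists (x, u) => //.
    by rewrite inE /=; apply/andP; split => //; rewrite inE; exact/andP.
  move=> [[x u]]; rewrite !inE /= => /andP[/andP[xS uU] xu] ->.
  by exists x => //; exists u => //; rewrite inE uU.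
rewrite card_in_imfset /=; last first.
  move=> [x u] [y v]; rewrite !inE /= => /andP[/andP[xS _] xu] /andP[/andP[yS _] yv] e.
  have : x \in [fset y; (y + v)%R] by rewrite -e !inE eqxx.
  rewrite !inE => /orP[/eqP xy|/eqP xyv]; last by rewrite -xyv xS in yv.
  subst y; have : (x + u)%R \in [fset x; (x + v)%R] by rewrite -e !inE eqxx orbT.
  rewrite !inE => /orP[/eqP xux|/eqP /addrI -> //].
  by rewrite xux xS in xu.
rewrite card_fset_sum_cond big_imfset2 /=; last by move=> [a b] [a' b'] _ _ /= [-> ->].
under eq_bigr do rewrite big_U.
rewrite exchange_big /=; apply: eq_bigr => i _.
by rewrite (partition_big_imfset _ (flat i)).
Qed.

Lemma seq_maximal (T : eqType) (f : T -> int) (s : seq T) : s != [::] ->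
  exists2 a, a \in s & {in s, forall b : T, f b <= f a}%R.
Proof.
elim: s => // x s IH _; case: (eqVneq s [::]) => [->|/IH [a aS amax]].
  by exists x; rewrite ?inE // => y; rewrite inE => /eqP ->.
have [xa|ax] := leP (f x) (f a).
  by exists a => [|y]; rewrite inE ?aS ?orbT // => /orP[/eqP ->|/amax].
exists x => [|y]; rewrite inE ?eqxx // => /orP[/eqP ->|/amax ya]; first exact: lexx.
exact: le_trans ya (ltW ax).
Qed.

Lemma fset_maximal (f : 'rV[int]_d -> int) S : S != fset0 ->
  exists2 a, a \in S & {in S, forall x, f x <= f a}%R.
Proof.
move=> S0; apply: seq_maximal; apply: contra_neq S0 => S0.
by apply/fsetP => x; rewrite inE -[_ \in _]/(x \in enum_fset S) S0.
Qed.

Section Side.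
Variables (i : 'I_d) (S : {fset 'rV[int]_d}) (y : 'rV[int]_d) (e : int).
Hypotheses (yS : y \in lines i S) (e1 : (e * e = 1)%R).

Let F := [fset x in S | flat i x == y].

Let shift_F m x : x \in F -> (shift i m x \in S) = (shift i m x \in F).
Proof. by rewrite !inE flat_shift /= => /andP[_ ->]; rewrite andbT. Qed.

Let lt_shift x (k : int) : (0 < k -> e * x ord0 i < e * shift i (e * k) x ord0 i)%R.
Proof. by move=> k0; rewrite shiftE eqxx mulrDr mulrA e1 mul1r ltrDl. Qed.

Let top_out a (k : int) : a \in F -> {in F, forall x, e * x ord0 i <= e * a ord0 i}%R ->
  (0 < k)%R -> shift i (e * k)%R a \notin S.
Proof.
move=> aF amax k0; rewrite shift_F //; apply/negP => /amax.
by rewrite leNgt lt_shift.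
Qed.

Let F_top : exists2 a, a \in F & {in F, forall x, e * x ord0 i <= e * a ord0 i}%R.
Proof.
apply: (@fset_maximal (fun x => e * x ord0 i)%R).
by rewrite -cardfs_gt0 (len_gt0 yS).
Qed.

(** The sign [e] selects one end of the line; the extreme point there leaves [S] under every outward
    jump. *)
Lemma side_ge1 (k : int) : (0 < k)%R ->
  1 <= \sum_(x <- S | flat i x == y) (shift i (e * k)%R x \notin S).
Proof.
move=> k0; have [a aF amax] := F_top.
rewrite big_fset_condE -/F (big_fsetD1 a) //=.
by rewrite top_out.
Qed.

(** The extreme point [a] loses both jumps, and the next point [b] loses at least one, since inside
    [S] both could only land on [a]. *)
Lemma side_ge2 : 1 < len i S y ->
  3 <= \sum_(x <- S | flat i x == y)
    ((shift i (e * 1)%R x \notin S) + (shift i (e * 2)%R x \notin S)).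
Proof.
rewrite /len -/F => F2; have [a aF amax] := F_top.
have [|b bFa bmax] := @fset_maximal (fun x => e * x ord0 i)%R (F `\ a).
  by rewrite -cardfs_gt0; move: F2; rewrite (cardfsD1 a) aF.
rewrite big_fset_condE -/F.
have t1 := top_out aF amax (erefl : (0 < 1 :> int)%R).
have t2 := top_out aF amax (erefl : (0 < 2 :> int)%R).
rewrite (big_fsetD1 a) //= (big_fsetD1 b) //= t1 t2 /=.
suff : 1 <= (shift i (e * 1)%R b \notin S) + (shift i (e * 2)%R b \notin S).
  by move=> h; rewrite -[3]/(2 + 1)%N leq_add2l; apply: leq_trans h (leq_addr _ _).
have bF : b \in F by move: bFa; rewrite !inE => /andP[].
rewrite !shift_F //.
have toa (k : int) : shift i (e * k)%R b \in F -> (0 < k)%R -> shift i (e * k)%R b = a.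
  move=> kF k0; apply/eqP/negPn/negP => ka.
  have := bmax (shift i (e * k)%R b); rewrite in_fsetD1 ka kF => /(_ isT).
  by rewrite leNgt lt_shift.
case: (boolP (shift i (e * 1)%R b \in F)) => [/toa h1|]; last by rewrite addn_gt0.
case: (boolP (shift i (e * 2)%R b \in F)) => [/toa h2|]; last by rewrite addn_gt0.
have := h1 isT; rewrite -h2 // => /rowP /(_ i); rewrite !shiftE eqxx => /addrI.
by move/(congr1 ( *%R e)); rewrite !mulrA e1.
Qed.

End Side.

Let mul11 : (1 * 1 = 1 :> int)%R. Proof. by rewrite mulr1. Qed.

Let mulN1N1 : (-1 * -1 = 1 :> int)%R. Proof. by rewrite mulrNN mulr1. Qed.

Lemma line_cost_split i S y : line_cost i S y =
  \sum_(m <- jumps i) \sum_(x <- S | flat i x == y) (shift i m x \notin S).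
Proof. exact: exchange_big. Qed.

Lemma line_cost_ge2 i S y : y \in lines i S -> 2 <= line_cost i S y.
Proof.
move=> yS; rewrite line_cost_split.
have h1 := side_ge1 yS mul11 (erefl : (0 < 1 :> int)%R).
have h2 := side_ge1 yS mulN1N1 (erefl : (0 < 1 :> int)%R).
rewrite !mulr1 in h1 h2; rewrite /jumps; case: ifP => _; rewrite !big_cons.
  exact: (leq_add h1 (leq_add h2 (leq0n _))).
exact: (leq_add h1 (leq_add h2 (leq0n _))).
Qed.

Lemma line_cost_ge4 (i : 'I_d) S y : i = 0%N :> nat -> y \in lines i S -> 4 <= line_cost i S y.
Proof.
move=> i0 yS; rewrite line_cost_split.
have h1 := side_ge1 yS mul11 (erefl : (0 < 1 :> int)%R).
have h2 := side_ge1 yS mulN1N1 (erefl : (0 < 1 :> int)%R).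
have h3 := side_ge1 yS mul11 (erefl : (0 < 2 :> int)%R).
have h4 := side_ge1 yS mulN1N1 (erefl : (0 < 2 :> int)%R).
rewrite ?mulr1 ?mul1r ?mulN1r in h1 h2 h3 h4; rewrite /jumps i0 eqxx !big_cons big_nil.
exact: (leq_add h1 (leq_add h2 (leq_add h3 (leq_add h4 (leqnn 0))))).
Qed.

Lemma line_cost_ge6 (i : 'I_d) S y : i = 0%N :> nat -> y \in lines i S -> 1 < len i S y ->
  6 <= line_cost i S y.
Proof.
move=> i0 yS y2; rewrite line_cost_split.
have h1 := side_ge2 yS mul11 y2.
have h2 := side_ge2 yS mulN1N1 y2.
rewrite !big_split ?mulr1 ?mul1r ?mulN1r /= in h1 h2.
rewrite /jumps i0 eqxx !big_cons big_nil addn0 [X in _ <= _ + X]addnCA addnA.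
exact: (leq_add h1 h2).
Qed.

End Boundary.

(** * Boxes and sets of optimal boundary *)

Definition iv (n : nat) : {fset int} := [fset Posz j | j : 'I_n in 'I_n].

Lemma in_iv n z : (z \in iv n) = (0 <= z < n%:Z)%R.
Proof.
apply/imfsetP/andP => [[j _ ->]|[z0 zn]].
  by rewrite lez_nat ltz_nat leq0n ltn_ord.
case: z z0 zn => // z _; rewrite ltz_nat => zn.
by exists (Ordinal zn).
Qed.

Lemma card_iv n : #|` iv n| = n.
Proof.
rewrite card_imfset /=; last by move=> i j [/val_inj].
by rewrite -cardE card_ord.
Qed.

(** The conditional is the distance to the end being crossed, so few positions can leave the
    interval under the jump [m]. *)
Lemma iv_exit (b m z : int) : (0 <= z < b -> ~~ (0 <= z + m < b) ->
  0 <= (if 0 < m then b - 1 - z else z) < `|m|%N%:Z)%R.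
Proof. by case: ifP; lia. Qed.

Section Sides.
Variables (d k : nat).
Implicit Types (x y : 'rV[int]_d.+1) (S X : {fset 'rV[int]_d.+1}).
Implicit Types (A : 'I_d.+1 -> {fset int}) (i j : 'I_d.+1) (c : int).

(** A line with at least two points costs at least 6 in direction 0 and 2 otherwise; [2 * sides i]
    is [k] times this bound in every direction. *)
Definition sides i : nat := if i == 0%N :> nat then 3 * k else k.

Lemma line_cost_iv (b : 'I_d.+1 -> nat) i y (B := box (fun i => iv (b i))) :
  k * line_cost i B y <= 2 * sides i.
Proof.
have out m : \sum_(x <- B | flat i x == y) (shift i m x \notin B) <= `|m|%N.
  rewrite big_fset_condE -card_fset_sum_cond -[leqRHS]card_iv.
  apply: (leq_card_in_fset
    (f := fun x => if (0 < m)%R then (b i)%:Z - 1 - x ord0 i else x ord0 i)%R).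
    move=> x x'; rewrite !inE => /andP[/andP[_ /eqP ex] _] /andP[/andP[_ /eqP ex'] _] e.
    by apply: (@flat_inj _ i); [rewrite ex ex'|move: e; case: ifP => _ e; lia].
  move=> x; rewrite !inE => /andP[/andP[/boxP xB _] sB]; rewrite in_iv.
  have := xB i; rewrite in_iv => xi.
  have : ~~ (0 <= x ord0 i + m < (b i)%:Z)%R.
    apply: contra sB => sx; apply/boxP => j; rewrite shiftE.
    by case: eqP => [->|_]; rewrite ?in_iv // addr0; have := xB j; rewrite in_iv.
  exact: iv_exit.
rewrite line_cost_split /jumps /sides; case: ifP => _; rewrite !big_cons big_nil.
  have := leq_add (out 1%R) (leq_add (out (-1)%R) (leq_add (out 2%R) (leq_add (out (-2)%R) (leqnn 0)))).
  by move/(leq_mul (leqnn k))/leq_trans; apply; lia.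
have := leq_add (out 1%R) (leq_add (out (-1)%R) (leqnn 0)).
by move/(leq_mul (leqnn k))/leq_trans; apply; lia.
Qed.

Lemma card_lines_box A i : #|` lines i (box A)| <= \prod_(j | j != i) #|` A j|.
Proof.
have -> : \prod_(j | j != i) #|` A j| = #|` box (upd A i [fset 0%R])|.
  rewrite card_box [RHS](bigD1 i) //= {1}/upd eqxx cardfs1 mul1n.
  by apply: eq_bigr => j ji; rewrite /upd (negPf ji).
apply: fsubset_leq_card; apply/fsubsetP => _ /imfsetP[x /= /boxP xA ->].
apply/boxP => j; rewrite mxE /upd; case: ifP => _; first by rewrite inE.
exact: xA.
Qed.

Lemma edge_boundary_iv (b : 'I_d.+1 -> nat) :
  k * edge_boundary (genU d.+1) (box (fun i => iv (b i))) <=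
  2 * \sum_i sides i * \prod_(j | j != i) b j.
Proof.
rewrite edge_boundaryE !big_distrr /=; apply: leq_sum => i _.
rewrite mulnA; apply: (@leq_trans (2 * sides i * #|` lines i (box (fun i => iv (b i)))|)).
  rewrite card_fset_sum1 !big_distrr /=; apply: leq_sum => y _.
  by rewrite muln1 line_cost_iv.
rewrite leq_mul2l (leq_trans (card_lines_box _ _)) ?orbT //.
by under eq_bigr do rewrite card_iv.
Qed.

Lemma line_cost_ge_sides S i y : y \in lines i S -> i != 0%N :> nat ->
  2 * sides i <= k * line_cost i S y.
Proof.
move=> yS /negPf i0; rewrite /sides i0 mulnC leq_mul2l.
by rewrite line_cost_ge2 ?orbT.
Qed.

(** Single-point lines of direction 0 are only known to cost 4 instead of 6, so they are charged
    separately, to their points. *)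
Lemma line0_cost_ge S : 
  2 * sides ord0 * #|` lines ord0 [fset x in S | 1 < len ord0 S (flat ord0 x)]| +
  4 * k * #|` [fset x in S | ~~ (1 < len ord0 S (flat ord0 x))]| <=
  \sum_(y <- lines ord0 S) k * line_cost ord0 S y.
Proof.
set S1 := [fset x in S | _].
apply: (@leq_trans (\sum_(y <- lines ord0 S)
  (2 * sides ord0 * (1 < len ord0 S y) + 4 * k * (~~ (1 < len ord0 S y) * len ord0 S y)))).
  rewrite big_split -!big_distrr /=; apply: leq_add.
    rewrite leq_mul2l -card_fset_sum_cond fsubset_leq_card ?orbT //.
    apply/fsubsetP => y /imfsetP[x /= xS1 ->]; move: xS1; rewrite !inE => /andP[xS h].
    by rewrite h mem_lines.
  rewrite leq_mul2l card_fset_sum_cond (partition_big_imfset _ (flat ord0)) /=.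
  rewrite leq_sum ?orbT // => y _.
  have e : \sum_(x <- S | flat ord0 x == y) 1 = len ord0 S y.
    by rewrite /len card_fset_sum1 -big_fset_condE.
  rewrite -[X in _ <= _ * X]e big_distrr /=.
  by apply: leq_sum => x /eqP xy; rewrite xy muln1.
rewrite big_seq [leqRHS]big_seq; apply: leq_sum => y yS; rewrite /sides /=.
have := line_cost_ge4 (erefl : (ord0 : 'I_d.+1) = 0%N :> nat) yS.
case: (boolP (1 < _)) => [h|h] /=.
  have := line_cost_ge6 (erefl : (ord0 : 'I_d.+1) = 0%N :> nat) yS h; nia.
have : len ord0 S y <= 1 by rewrite leqNgt.
nia.
Qed.

Lemma optimal_is_box S : d.+1 < 2 * k -> #|` S| = \prod_i sides i ->
  k * edge_boundary (genU d.+1) S <= 2 * d.+1 * #|` S| ->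
  exists2 A : 'I_d.+1 -> {fset int}, S = box A & forall i, #|` A i| = sides i.
Proof.
move=> dk cardS; rewrite edge_boundaryE big_distrr /= => bd.
have k0 : 0 < k by case: (k) dk.
have S0 : 0 < #|` S|.
  by rewrite cardS prodn_gt0 // => i; rewrite /sides; case: ifP => _; rewrite ?muln_gt0 k0.
set S1 := [fset x in S | 1 < len ord0 S (flat ord0 x)].
set S2 := [fset x in S | ~~ (1 < len ord0 S (flat ord0 x))].
have S1S : S1 `<=` S by apply/fsubsetP => x; rewrite !inE => /andP[].
have cS : (#|` S1| + #|` S2| = #|` S|)%N.
  rewrite -(cardfsID S1 S); congr (_ + _)%N; congr #|` _|.
    by apply/esym/fsetIidPr.
  by apply/fsetP => x; rewrite !inE; case: (x \in S) => //=; rewrite andbT.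
have lower : 2 * \sum_i sides i * #|` lines i S1| + 4 * k * #|` S2| <= 2 * d.+1 * #|` S|.
  apply: leq_trans bd; rewrite (bigD1 ord0) //= [leqRHS](bigD1 ord0) //=.
  rewrite mulnDr addnAC; apply: leq_add.
    by rewrite mulnA big_distrr /=; apply: line0_cost_ge.
  rewrite big_distrr /=; apply: leq_sum => i i0.
  rewrite mulnA; apply: (@leq_trans (2 * sides i * #|` lines i S|)).
    by rewrite leq_mul2l fsubset_leq_card ?orbT // linesS.
  rewrite card_fset_sum1 !big_distrr big_seq [leqRHS]big_seq /=.
  by apply: leq_sum => y yS; rewrite muln1 line_cost_ge_sides.
have c1 : #|` S1| <= \prod_i sides i by rewrite -cardS fsubset_leq_card.
have lines1 := sum_lines_ge_card (tperm ord0 ord0) c1.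
(* By the Knothe bound, [S1] uses up its share of the budget, while each point of [S2] costs
   [4 * k], more than its share [2 * d.+1]. *)
have S20 : #|` S2| = 0.
  move: dk lines1 lower; rewrite -cS; move: (\sum_i _) #|` S1| #|` S2|; nia.
have S1E : S1 = S.
  by apply/eqP; rewrite eqEfcard S1S -cS S20 addn0 leqnn.
apply: sum_lines_eq_box => //.
by move: lower; rewrite S20 muln0 addn0 S1E -mulnA leq_mul2l.
Qed.

End Sides.

(** * Slabs between two nested boxes *)

Section Pairs.
Variables (I : finType) (T : choiceType) (B : I -> {fset T}).

Definition pairs : seq (I * T) := [seq (j, c) | j <- index_enum I, c <- enum_fset (B j)].

Lemma uniq_pairs : uniq pairs.
Proof.
apply: allpairs_uniq_dep => [|i _|[i x] [j y] _ _ /= [-> ->]] //.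
exact: index_enum_uniq.
Qed.

Lemma mem_pairs p : (p \in pairs) = (p.2 \in B p.1).
Proof.
apply/allpairsPdep/idP => [[j [c [_ cj ->]]] //|].
by case: p => j c /= h; exists j, c; rewrite mem_index_enum.
Qed.

Lemma big_pairs (P : pred I) (F : I * T -> nat) :
  \sum_(p <- pairs | P p.1) F p = \sum_(j | P j) \sum_(c <- B j) F (j, c).
Proof.
rewrite big_mkcond big_allpairs_dep [RHS]big_mkcond /=.
by apply: eq_bigr => j _; case: (P j) => //; rewrite big1.
Qed.

End Pairs.

Section Slabs.
Variables (d k : nat) (A A' : 'I_d.+1 -> {fset int}).
Implicit Types (x y : 'rV[int]_d.+1) (S X : {fset 'rV[int]_d.+1}).
Implicit Types (i j : 'I_d.+1) (c : int).

Local Notation a := (@sides d k).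
Local Notation D j := (A' j `\` A j).

Hypotheses (k0 : 0 < k) (cA : forall i, #|` A i| = a i) (AA' : forall i, A i `<=` A' i).

(** Parts of [box A'] where two or more coordinates leave [A] belong to no slab; these corners are
    the lower-order error. *)
Definition slab j c := box (upd A j [fset c]).

Lemma sides_gt0 i : 0 < a i.
Proof. by rewrite /sides; case: ifP => _; rewrite ?muln_gt0 k0. Qed.

Lemma slab_sub j c : c \in D j -> slab j c `<=` box A'.
Proof.
rewrite inE => /andP[_ cA']; apply/fsubsetP => x /boxP xs; apply/boxP => i.
have := xs i; rewrite /upd; case: eqP => [->|_]; first by rewrite inE => /eqP ->.
by move/(fsubsetP (AA' i)).
Qed.

Lemma card_slab j c : #|` slab j c| = \prod_(i | i != j) a i.
Proof.
rewrite card_box (bigD1 j) //= {1}/upd eqxx cardfs1 mul1n.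
by apply: eq_bigr => i ij; rewrite /upd (negPf ij) cA.
Qed.

Lemma slab_coord j c x : x \in slab j c -> x ord0 j = c.
Proof. by move/boxP/(_ j); rewrite /upd eqxx inE => /eqP. Qed.

Lemma slab_coord' j c x i : x \in slab j c -> i != j -> x ord0 i \in A i.
Proof. by move=> /boxP/(_ i) h /negPf ij; move: h; rewrite /upd ij. Qed.

(** Agreement is asked only in coordinates [j] and [j'], so that the lemma separates lines of other
    directions as well as points. *)
Lemma slab_disjoint j c j' c' x x' : c \in D j -> c' \in D j' ->
  x \in slab j c -> x' \in slab j' c' ->
  x ord0 j = x' ord0 j -> x ord0 j' = x' ord0 j' -> (j, c) = (j', c').
Proof.
rewrite !inE => /andP[cj _] /andP[cj' _] xs xs' ej ej'.
case: (eqVneq j j') => [jj'|jj'].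
  by subst j'; rewrite -(slab_coord xs) -(slab_coord xs') ej.
by move: cj; rewrite -(slab_coord xs) ej (slab_coord' xs').
Qed.

(** A line of direction [i] has constant coordinate [j] for [j != i], which tells the slabs from
    each other and from [box A]. Slabs of direction [i] are left out because their points lie on
    lines of [box A]. *)
Lemma sum_pieces_lines S i (g : 'rV[int]_d.+1 -> nat) : box A `<=` S ->
  \sum_(y <- lines i (box A)) g y +
  \sum_(j | j != i) \sum_(c <- D j) \sum_(y <- lines i (S `&` slab j c)) g y <=
  \sum_(y <- lines i S) g y.
Proof.
move=> AS.
pose P (t : option ('I_d.+1 * int)) := if t is Some p then p.1 != i else true.
pose B (t : option ('I_d.+1 * int)) :=
  lines i (if t is Some p then S `&` slab p.1 p.2 else box A).
have := @sum_disjoint_le _ _ (None :: map Some (pairs (fun j => D j))) P B (lines i S) g.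
rewrite big_cons big_map /= (big_pairs _ (fun j => j != i)) /=; apply.
- rewrite map_inj_uniq ?uniq_pairs ?andbT; last exact: Some_inj.
  by apply/negP => /mapP[].
- by move=> [p|] _ _; apply: linesS => //; apply: fsubsetIl.
- move=> [[j c]|] [[j' c']|] y; rewrite ?inE ?(mem_map (@Some_inj _)) ?mem_pairs //=.
  + move=> cD cD' ji j'i /imfsetP[x /=]; rewrite in_fsetI => /andP[_ xs] ->.
    move=> /imfsetP[x' /=]; rewrite in_fsetI => /andP[_ xs'] /eqP/flatP e.
    by congr Some; apply: (slab_disjoint cD cD' xs xs'); apply: e.
  + move=> cD _ ji _ /imfsetP[x /=]; rewrite in_fsetI => /andP[_ xs] ->.
    move=> /imfsetP[x' /= /boxP x'A] /eqP/flatP/(_ j ji) e.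
    by move: cD; rewrite inE -(slab_coord xs) e x'A.
  + move=> _ cD _ ji /imfsetP[x' /= /boxP x'A] ->.
    move=> /imfsetP[x /=]; rewrite in_fsetI => /andP[_ xs] /eqP/flatP/(_ j' ji) e.
    by move: cD; rewrite inE -(slab_coord xs) -e x'A.
Qed.

(** The unfilled parts of the slabs are disjoint subsets of [box A'] outside [S]. *)
Lemma sum_slabs_card S : box A `<=` S -> S `<=` box A' ->
  #|` S| + \sum_j \sum_(c <- D j) #|` slab j c| <=
  #|` box A'| + \sum_j \sum_(c <- D j) #|` S `&` slab j c|.
Proof.
move=> AS SA'.
pose B (p : 'I_d.+1 * int) := slab p.1 p.2 `\` S.
have := @sum_disjoint_le _ _ (pairs (fun j => D j)) predT B (box A' `\` S) (fun=> 1).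
rewrite (big_pairs _ predT) -card_fset_sum1 cardfsDS //= => h.
rewrite -leq_subRL ?(leq_trans (fsubset_leq_card SA')) ?leq_addr // addnC -addnBA ?fsubset_leq_card //.
apply: (@leq_trans (\sum_j \sum_(c <- D j) (#|` S `&` slab j c| + \sum_(y <- B (j, c)) 1))).
  apply: leq_sum => j _; apply: leq_sum => c _.
  by rewrite -card_fset_sum1 fsetIC cardfsID.
under eq_bigr do rewrite big_split.
rewrite big_split leq_add2l; apply: h.
- exact: uniq_pairs.
- move=> [j c]; rewrite mem_pairs /= => cD _.
  by apply: fsetSD; apply: slab_sub.
- move=> [j c] [j' c'] x; rewrite !mem_pairs /= => cD cD' _ _.
  rewrite !in_fsetD => /andP[_ xs] /andP[_ xs'].
  exact: (slab_disjoint cD cD' xs xs').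
Qed.

Lemma sum_slabs_card_ge S : box A `<=` S ->
  #|` box A| + \sum_j \sum_(c <- D j) #|` S `&` slab j c| <= #|` S|.
Proof.
move=> AS.
pose B (p : 'I_d.+1 * int) := S `&` slab p.1 p.2.
have := @sum_disjoint_le _ _ (pairs (fun j => D j)) predT B (S `\` box A) (fun=> 1).
rewrite (big_pairs _ predT) -card_fset_sum1 cardfsDS //= => h.
rewrite -leq_subRL ?fsubset_leq_card //.
rewrite (eq_bigr (fun j => \sum_(c <- D j) \sum_(y <- B (j, c)) 1)); last first.
  by move=> j _; apply: eq_bigr => c _; rewrite card_fset_sum1.
apply: h.
- exact: uniq_pairs.
- move=> [j c]; rewrite mem_pairs /= => cD _; apply/fsubsetP => x.
  rewrite in_fsetI in_fsetD => /andP[-> xs]; rewrite andbT; apply/boxP => /(_ j).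
  by move: cD; rewrite (slab_coord xs) inE => /andP[/negPf ->].
- move=> [j c] [j' c'] x; rewrite !mem_pairs /= => cD cD' _ _.
  rewrite !in_fsetI => /andP[_ xs] /andP[_ xs'].
  exact: (slab_disjoint cD cD' xs xs').
Qed.

(* The bound is linear in the number of points so as to survive lines of
   direction 0 with a single point, which cost 4 instead of 6. *)
Lemma piece_cost S X i : X `<=` S -> (forall y, len i X y <= a i) ->
  a i * #|` lines i X| + #|` X| <= \sum_(y <- lines i X) k * line_cost i S y.
Proof.
move=> XS lenX; rewrite -(sum_len i X) card_fset_sum1 big_distrr -big_split /=.
rewrite big_seq [leqRHS]big_seq; apply: leq_sum => y yX; rewrite muln1.
have yS := fsubsetP (linesS i XS) y yX.
have lS := lenS i y XS.
have l0 := len_gt0 yX.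
have lX := lenX y.
case: (eqVneq (i : nat) 0) => i0; last first.
  by apply: leq_trans (line_cost_ge_sides k yS i0); rewrite mul2n -addnn leq_add2l.
move: lX; rewrite /sides i0 eqxx => lX.
have c4 := line_cost_ge4 i0 yS; have c6 := line_cost_ge6 i0 yS.
case: (leqP (len i X y) 1) => l1; first by nia.
have {}c6 := c6 (leq_trans l1 lS).
nia.
Qed.

Lemma len_piece S j c i y : i != j -> len i (S `&` slab j c) y <= a i.
Proof.
move=> ij; rewrite -cA; have := @len_box _ (upd A j [fset c]) i (S `&` slab j c) y.
by rewrite /upd (negPf ij); apply; apply: fsubsetIr.
Qed.

(** This is [sum_lines_ge] in the slab. Its side [j] is a single value, so direction [j] has at most
    as many lines as [X] has points and uses up one of the [d.+1] linear terms. *)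
Lemma slab_excess S j c (X := S `&` slab j c) :
  minn #|` X| (#|` slab j c| - #|` X|) + 4 * d * #|` X| <=
  2 * \sum_(i | i != j) (a i * #|` lines i X| + #|` X|).
Proof.
have XQ : X `<=` slab j c by apply: fsubsetIr.
have := sum_lines_ge XQ; rewrite -/(slab j c) (bigD1 j) //=.
rewrite (_ : #|` upd A j [fset c] j| = 1) ?mul1n; last by rewrite /upd eqxx cardfs1.
rewrite (eq_bigr (fun i => a i * #|` lines i X|)); last first.
  by move=> i ij; rewrite /upd (negPf ij) cA.
rewrite big_split sum_nat_const /= cardC1 card_ord.
have Q0 : 0 < #|` slab j c|.
  by rewrite card_slab prodn_cond_gt0 // => i _; apply: sides_gt0.
have := fsubset_leq_card XQ; have := card_lines j X.
move: (\sum_(i | _) _) #|` lines j X| #|` X| #|` slab j c| Q0 => T l n q q0 ln nq h.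
(* The larger of [n] and [q - n] is at least half of [q]. *)
rewrite -(leq_pmul2l q0); have : minn n (q - n) * q <= 2 * (n * (q - n)).
  by case: leqP => ?; nia.
nia.
Qed.

(** In each direction, [piece_cost] pays separately for the lines of [box A] and of the pieces in
    slabs of other directions; exchanging the sums brings in [slab_excess] slab by slab. *)
Lemma boundary_slabs S : box A `<=` S ->
  4 * d.+1 * #|` box A| + \sum_j \sum_(c <- D j)
    (minn #|` S `&` slab j c| (#|` slab j c| - #|` S `&` slab j c|)
     + 4 * d * #|` S `&` slab j c|)
  <= 2 * (k * edge_boundary (genU d.+1) S).
Proof.
move=> AS; rewrite edge_boundaryE.
apply: (@leq_trans (2 * \sum_i (2 * #|` box A| +
   \sum_(j | j != i) \sum_(c <- D j)
     (a i * #|` lines i (S `&` slab j c)| + #|` S `&` slab j c|)))); last first.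
  rewrite leq_mul2l big_distrr /=; apply: leq_sum => i _.
  rewrite big_distrr /=; apply: leq_trans (sum_pieces_lines _ _ AS).
  apply: leq_add.
    apply: leq_trans (piece_cost AS _); last first.
      by move=> y; rewrite -cA; apply: len_box.
    rewrite mul2n -addnn leq_add2r -(sum_len i (box A)) card_fset_sum1 big_distrr /=.
    by apply: leq_sum => y _; rewrite muln1 -cA len_box.
  apply: leq_sum => j ji; apply: leq_sum => c _; apply: piece_cost.
    exact: fsubsetIl.
  by move=> y; apply: len_piece; rewrite eq_sym.
rewrite big_split /= sum_nat_const card_ord mulnDr; apply: leq_add.
  by apply: eq_leq; ring.
rewrite (exchange_big_dep predT) //= big_distrr /=; apply: leq_sum => j _.
rewrite exchange_big /= big_distrr /=; apply: leq_sum => c _.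
rewrite (eq_bigl (fun i => i != j)); last by move=> i; rewrite eq_sym.
exact: slab_excess.
Qed.

End Slabs.

(** * Optimal sets between two boxes *)

Section TestBox.
Variables (e k alpha beta : nat).
Local Notation d := e.+1.

Definition test_sides (i : 'I_d.+1) : nat :=
  if i == 0 :> nat then alpha else if i == 1 :> nat then beta else k.

Lemma prod_test_sides : \prod_i test_sides i = alpha * beta * k ^ e.
Proof.
rewrite !big_ord_recl /= mulnA; congr (_ * _)%N.
by rewrite (eq_bigr (fun=> k)) // prod_nat_const card_ord.
Qed.

Lemma sum_test_sides :
  \sum_i sides k i * \prod_(j | j != i) test_sides j =
  (3 * k * (beta * k ^ e) + k * (alpha * k ^ e) + e * (alpha * beta * k ^ e))%N.
Proof.
rewrite !big_ord_recl -addnA; congr (_ + (_ + _))%N.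
- rewrite /sides /=; congr (_ * _)%N.
  by rewrite big_mkcond !big_ord_recl /= /test_sides /= mul1n (eq_bigr (fun=> k)) // prod_nat_const card_ord.
- rewrite /sides /=; congr (_ * _)%N.
  by rewrite big_mkcond !big_ord_recl /= /test_sides /= mul1n (eq_bigr (fun=> k)) // prod_nat_const card_ord.
- rewrite -prod_test_sides -[X in X * _]card_ord -sum_nat_const.
  by apply: eq_bigr => i _; rewrite [RHS](bigD1 (lift ord0 (lift ord0 i))).
Qed.

Lemma optimal_boundary_le (N : nat) (S : {fset 'rV[int]_d.+1}) :
  3 * k <= alpha -> k <= beta -> N = alpha * beta * k ^ e ->
  edge_optimal (genU d.+1) N S ->
  k * edge_boundary (genU d.+1) S <= 2 * (3 * k ^ d.+1 + d * N).
Proof.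
move=> ak bk NE [cS opt].
have cB : #|` box (fun i => iv (test_sides i))| = N.
  by rewrite card_box NE -prod_test_sides; apply: eq_bigr => i _; rewrite card_iv.
apply: leq_trans (leq_mul (leqnn k) (opt _ cB)) _.
apply: leq_trans (edge_boundary_iv _ _) _.
rewrite sum_test_sides leq_mul2l /= NE !expnS.
(* The two sides differ by [(alpha - 3 * k) * (beta - k)], which is nonnegative. *)
suff : 3 * k * beta + k * alpha <= 3 * k * k + alpha * beta.
  move: (k ^ e) => p h; have : (3 * k * beta + k * alpha) * p <= (3 * k * k + alpha * beta) * p.
    by rewrite leq_mul2r h orbT.
  by nia.
have [u ->] : exists u, alpha = (3 * k + u)%N by exists (alpha - 3 * k); lia.
have [v ->] : exists v, beta = (k + v)%N by exists (beta - k); lia.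
nia.
Qed.

End TestBox.

Lemma prod_sides e k : \prod_i @sides e.+1 k i = 3 * k ^ e.+2.
Proof.
have -> : \prod_i @sides e.+1 k i = \prod_(i < e.+2) @test_sides e k (3 * k) k i.
  by apply: eq_bigr => i _; rewrite /sides /test_sides; case: ifP => // _; case: ifP.
by rewrite prod_test_sides !expnS -!mulnA.
Qed.

Lemma expn_succ_le e : exists C, forall k, 0 < k ->
  k.+1 ^ e.+2 <= k ^ e.+2 + e.+2 * k ^ e.+1 + C * k ^ e.
Proof.
elim: e => [|e [C IH]]; first by exists 1 => k _; rewrite !expnS !expn0; nia.
exists (2 * C + e.+2)%N => k k0; rewrite expnS.
apply: leq_trans (leq_mul (leqnn _) (IH k k0)) _.
rewrite !(expnS k); move: (k ^ e) => p; nia.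
Qed.

(** * Counting the filled slabs *)

Section Count.
Variables (e k : nat) (A A' : 'I_e.+2 -> {fset int}).
Implicit Types (S : {fset 'rV[int]_e.+2}).
Local Notation D j := (A' j `\` A j).

Hypotheses (cA : forall i, #|` A i| = sides k i) (cA' : forall i, #|` A' i| = sides k.+1 i).
Hypothesis AA' : forall i, A i `<=` A' i.
(** The volume of a slab of direction [j] in units of [k ^ e.+1]. *)
Definition weight (j : 'I_e.+2) : nat := if j == 0 :> nat then 1 else 3.

Definition filled S j c : bool := #|` slab A j c| < 2 * #|` S `&` slab A j c|.

Definition filled_weight S : nat := \sum_j \sum_(c <- D j) filled S j c * weight j.

Lemma card_D j : #|` D j| * weight j = 3.
Proof.
rewrite cardfsDS // cA cA' /weight /sides; case: ifP => _; lia.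
Qed.

Lemma filledS S T j c : S `<=` T -> filled S j c -> filled T j c.
Proof.
move=> ST; rewrite /filled => /leq_trans; apply.
by rewrite leq_mul2l fsubset_leq_card ?orbT // fsetSI.
Qed.

(** Modulo 3 the weight counts the filled slabs of direction 0, of which there are at most 3: weight
    2 means two of them, weight 4 exactly one. But filled slabs stay filled in a larger set. *)
Lemma filled_weight2_4 S T : S `<=` T -> filled_weight S = 2 -> filled_weight T = 4 -> False.
Proof.
move=> ST; rewrite /filled_weight !(bigD1 ord0 (P := predT)) //=.
have mult3 (U : {fset 'rV[int]_e.+2}) :
    \sum_(j < e.+2 | j != ord0) \sum_(c <- D j) filled U j c * weight j =
    3 * \sum_(j < e.+2 | j != ord0) \sum_(c <- D j) filled U j c.
  rewrite big_distrr; apply: eq_bigr => j j0; rewrite big_distrr; apply: eq_bigr => c _ /=.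
  by rewrite mulnC /weight (negPf (j0 : (j : nat) != 0%N)).
rewrite !mult3.
have mono : \sum_(c <- D ord0) filled S ord0 c * weight ord0 <=
    \sum_(c <- D ord0) filled T ord0 c * weight ord0.
  apply: leq_sum => c _; rewrite leq_mul2r; apply/orP; right.
  by case: (boolP (filled S ord0 c)) => // /(filledS ST) ->.
have bound : \sum_(c <- D ord0) filled T ord0 c * weight ord0 <= 3.
  rewrite -(card_D ord0) card_fset_sum1 big_distrl /=; apply: leq_sum => c _.
  by rewrite leq_mul2r leq_b1 orbT.
move: mono bound.
move: (\sum_(c <- D ord0) _) (\sum_(c <- D ord0) _) (\sum_(j < _ | _) _) (\sum_(j < _ | _) _).
lia.
Qed.

Variable C : nat.
Hypothesis C_k : k.+1 ^ e.+2 <= k ^ e.+2 + e.+2 * k ^ e.+1 + C * k ^ e.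
Hypothesis k_large : 12 * e.+2 * C + 2 < k.

Let k0 : 0 < k. Proof. by apply: leq_ltn_trans k_large. Qed.

Lemma card_slabE j c : #|` slab A j c| = weight j * k ^ e.+1.
Proof.
rewrite (card_slab cA); apply/eqP; rewrite -(eqn_pmul2l (sides_gt0 k0 j)).
have <- := bigD1 j (F := sides k) (P := predT) isT.
rewrite prod_sides /sides /weight (expnS k e.+1); apply/eqP.
by case: ifP => _; ring.
Qed.

Lemma sum_slabE : \sum_j \sum_(c <- D j) #|` slab A j c| = 3 * e.+2 * k ^ e.+1.
Proof.
rewrite (eq_bigr (fun=> 3 * k ^ e.+1)); last first.
  move=> j _; rewrite (eq_bigr (fun=> weight j * k ^ e.+1)); last first.
    by move=> c _; apply: card_slabE.
  rewrite -(card_D j) card_fset_sum1 !big_distrl /=.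
  by apply: eq_bigr => c _; rewrite mul1n.
by rewrite sum_nat_const card_ord; ring.
Qed.

(** Rounding each piece to an empty or full slab changes the total volume [X] by at most [M]. The
    boundary bound makes [M] smaller than the unit [k ^ e.+1], so the integer weight is determined
    by the size of [S]. *)
Lemma filled_weightE S q s : box A `<=` S -> S `<=` box A' ->
  #|` S| = (3 * k ^ e.+2 + q * k ^ e.+1 + s)%N -> s <= k ^ e ->
  k * edge_boundary (genU e.+2) S <= 2 * (3 * k ^ e.+2 + e.+1 * #|` S|) ->
  filled_weight S = q.
Proof.
move=> AS SA' cS sk bd.
have V : #|` box A| = 3 * k ^ e.+2.
  by rewrite card_box -prod_sides; apply: eq_bigr => i _; rewrite cA.
have V' : #|` box A'| = 3 * k.+1 ^ e.+2.
  by rewrite card_box -prod_sides; apply: eq_bigr => i _; rewrite cA'.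
have := sum_slabs_card AA' AS SA'; rewrite sum_slabE V' cS.
have := sum_slabs_card_ge A' AS; rewrite V cS.
have := boundary_slabs A' k0 cA AS; rewrite V.
pose gap j c := minn #|` S `&` slab A j c| (#|` slab A j c| - #|` S `&` slab A j c|).
rewrite (eq_bigr (fun j => \sum_(c <- D j) gap j c +
    4 * e.+1 * \sum_(c <- D j) #|` S `&` slab A j c|)); last first.
  by move=> j _; rewrite big_split -big_distrr.
rewrite big_split -big_distrr /=.
set X := \sum_j \sum_(c <- D j) #|` S `&` slab A j c|.
set M := \sum_j \sum_(c <- D j) gap j c.
have roundE : filled_weight S * k ^ e.+1 = \sum_j \sum_(c <- D j) filled S j c * #|` slab A j c|.
  rewrite big_distrl; apply: eq_bigr => j _; rewrite big_distrl; apply: eq_bigr => c _ /=.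
  by rewrite card_slabE mulnA.
have round1 : filled_weight S * k ^ e.+1 <= X + M.
  rewrite roundE -big_split; apply: leq_sum => j _; rewrite -big_split; apply: leq_sum => c _ /=.
  have := fsubset_leq_card (fsubsetIr S (slab A j c)); rewrite /filled /gap.
  move: #|` _| #|` _| => x w; lia.
have round2 : X <= filled_weight S * k ^ e.+1 + M.
  rewrite roundE -big_split; apply: leq_sum => j _; rewrite -big_split; apply: leq_sum => c _ /=.
  have := fsubset_leq_card (fsubsetIr S (slab A j c)); rewrite /filled /gap.
  move: #|` _| #|` _| => x w; lia.
have p0 : 0 < k ^ e by rewrite expn_gt0 k0.
have large1 : (12 * e.+1 * C + 1) * k ^ e < k * k ^ e by rewrite ltn_pmul2r //; lia.
have large2 : 12 * e.+2 * C * k ^ e < k * k ^ e by rewrite ltn_pmul2r //; lia.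
move: bd round1 round2 C_k sk large1 large2; rewrite cS -expnS.
move: (filled_weight S) X M (edge_boundary _ _) => Z X M bS.
have K0 : 0 < k ^ e.+1 by rewrite expn_gt0 k0.
move: (k ^ e.+2) (k.+1 ^ e.+2) (k ^ e.+1) (k ^ e) K0 => V0 V1 K p K0.
move=> bd r1 r2 Ck sk large1 large2 hb hX1 hX2.
(* The term [3 * C * p] bounds the volume of the corners of [box A']. *)
have hr : q * K + s <= X + 3 * C * p by lia.
(* The linear terms of the two boundary bounds leave [M] at most [4 * e.+1] times the corner
   volume. *)
have hM : M <= 12 * e.+1 * C * p.
  have := leq_mul (leqnn (4 * e.+1)) hr; lia.
apply/eqP; rewrite eqn_leq -(ltnS Z) -(ltnS q); apply/andP; split.
  by rewrite -(ltn_pmul2r K0); lia.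
by rewrite -(ltn_pmul2r K0); lia.
Qed.

End Count.

(** * From nested optimal sets to the contradiction *)

Lemma box_subset d (A A' : 'I_d -> {fset int}) :
  (forall i, 0 < #|` A i|) -> box A `<=` box A' -> forall i, A i `<=` A' i.
Proof.
move=> A0 /fsubsetP AA' i; apply/fsubsetP => c cA.
have : 0 < #|` box (upd A i [fset c])|.
  by rewrite card_box prodn_gt0 // => j; rewrite /upd; case: ifP; rewrite ?cardfs1.
rewrite cardfs_gt0 => /fset0Pn[x /boxP xA].
have <- : x ord0 i = c by have := xA i; rewrite /upd eqxx inE => /eqP.
have /AA'/boxP// : x \in box A.
by apply/boxP => j; have := xA j; rewrite /upd; case: eqP => // -> /[!inE] /eqP ->.
Qed.

Theorem theorem1 (d : nat) (hd : 2 <= d) (n : nat) (Sn : {fset 'rV[int]_d})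
    (hSn : edge_optimal (genU d) n Sn) :
  ~ exists S : nat -> {fset 'rV[int]_d},
      S n = Sn /\
      forall i : nat, n <= i ->
        [/\ #|` S i| = i,
            S i `<=` S i.+1 &
            edge_optimal (genU d) i (S i)].
Proof.
case: d hd Sn hSn => [|[|e]] // _ Sn _ [S [_ hS]].
have [C hC] := expn_succ_le e.
have mono i j : n <= i -> i <= j -> S i `<=` S j.
  move=> ni; elim: j => [|j IH]; first by rewrite leqn0 => /eqP ->.
  rewrite leq_eqVlt => /orP[/eqP -> //|]; rewrite ltnS => ij.
  by have [_ + _] := hS j (leq_trans ni ij); apply: fsubset_trans; apply: IH.
(* At size [3 * k ^ e.+2] the test box has the sides [sides k], and comparison with it gives the
   hypothesis of [optimal_is_box]. *)
have full k : n <= k -> e.+2 < k -> exists2 A : 'I_e.+2 -> {fset int},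
    S (3 * k ^ e.+2) = box A & forall i, #|` A i| = sides k i.
  move=> nk ek; have k0 : 0 < k by apply: leq_ltn_trans ek.
  have nN : n <= 3 * k ^ e.+2.
    by apply: (leq_trans nk); rewrite expnS; have : 0 < k ^ e.+1; [rewrite expn_gt0 k0|nia].
  have [cS _ opt] := hS _ nN.
  apply: optimal_is_box; rewrite ?cS ?prod_sides //; first by nia.
  apply: leq_trans (optimal_boundary_le (leqnn _) (leqnn _) _ opt) _.
    by rewrite !expnS !mulnA.
  by apply: eq_leq; ring.
(* Large enough for the starting size [n], for [optimal_is_box] and for the error terms of
   [filled_weightE]. *)
pose k := (n + e.+3 + 12 * e.+2 * C + 2)%N.
have nk : n <= k by lia.
have ek : e.+2 < k by lia.
have k0 : 0 < k by lia.
have Ck : 12 * e.+2 * C + 2 < k by lia.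
have [A SA cA] := full k nk ek.
have [A' SA' cA'] := full k.+1 (leqW nk) (leqW ek).
have p0 : 0 < k ^ e by rewrite expn_gt0 k0.
(* These test boxes exceed [3 * k ^ e.+2] by 2 and by 4 slab units, the latter up to a remainder
   [k ^ e]. *)
pose N1 := ((3 * k + 2) * k * k ^ e)%N.
pose N2 := ((3 * k + 1) * (k + 1) * k ^ e)%N.
have [N0E N1E N2E] : [/\ 3 * k ^ e.+2 = 3 * k * k * k ^ e,
    N1 = (3 * k ^ e.+2 + 2 * k ^ e.+1 + 0)%N &
    N2 = (3 * k ^ e.+2 + 4 * k ^ e.+1 + k ^ e)%N].
  by rewrite /N1 /N2 !expnS; split; ring.
have N3 : N2 <= 3 * k.+1 ^ e.+2.
  have pq : k ^ e <= k.+1 ^ e by case: (posnP e) => [->|e0] //; rewrite leq_exp2r.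
  rewrite /N2 !expnS !mulnA; apply: leq_mul pq; lia.
have nN0 : n <= 3 * k ^ e.+2.
  by apply: (leq_trans nk); rewrite N0E; nia.
have N01 : 3 * k ^ e.+2 <= N1 by rewrite N1E -addnA leq_addr.
have N12 : N1 <= N2 by rewrite N1E N2E; lia.
have nN1 : n <= N1 := leq_trans nN0 N01.
have nN2 : n <= N2 := leq_trans nN1 N12.
have AA' : forall i, A i `<=` A' i.
  apply: box_subset => [i|]; first by rewrite cA sides_gt0.
  rewrite -SA -SA'; apply: mono => //.
  exact: leq_trans N01 (leq_trans N12 N3).
have [c1 _ o1] := hS _ nN1; have [c2 _ o2] := hS _ nN2.
apply: (filled_weight2_4 cA cA' AA' (S := S N1) (T := S N2)).
- exact: mono.
- apply: (filled_weightE cA cA' AA' (hC k k0) Ck (s := 0)).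
  + by rewrite -SA; apply: mono.
  + by rewrite -SA'; apply: mono => //; apply: leq_trans N12 N3.
  + by rewrite c1.
  + by [].
  + by rewrite c1; apply: (optimal_boundary_le _ _ (erefl N1) o1); lia.
- apply: (filled_weightE cA cA' AA' (hC k k0) Ck (s := k ^ e)).
  + by rewrite -SA; apply: mono => //; apply: leq_trans N01 N12.
  + by rewrite -SA'; apply: mono.
  + by rewrite c2.
  + by [].
  + by rewrite c2; apply: (optimal_boundary_le _ _ (erefl N2) o2); lia.
Qed.
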